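(* Let $X$ be an $n\times p$ real data matrix with columns $X_1,\dots,X_p$, and let $c_1>0$, $c_2\ge0$, $\gamma>0$, $\kappa\ge0$, $\alpha\in(0,1)$. For a DAG $G$ with vertex set $[p]=\{1,\dots,p\}$ define $$\psi(G)=\sum_{j=1}^p\psi_j(\mathrm{Pa}_j(G)),\qquad e^{\psi_j(S)}=(c_1p^{c_2})^{-|S|}(1+\alpha\gamma^{-1})^{-|S|/2}\left\{X_j^\top\left(I-X_S(X_S^\top X_S)^{-1}X_S^\top\right)X_j\right\}^{-(\alpha n+\kappa)/2}.$$ Then $\psi(G)=\psi(G')$ whenever $G$ and $G'$ are Markov equivalent DAGs.
   Context: $\mathrm{Pa}_j(G)$ is the set of parents of node $j$ in $G$; $X_S$ is the submatrix of $X$ with columns indexed by $S$ (for $S=\emptyset$ the projection $X_S(X_S^\top X_S)^{-1}X_S^\top$ is $0$). Two DAGs are Markov equivalent if they encode the same set of conditional independence (d-separation) relations. It is understood that $X$ is such that the expressions defining $\psi(G)$ and $\psi(G')$ make sense (the matrices $X_S^\top X_S$ involved are invertible and the residual sums of squares in braces are positive). *)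

(* Defs.v *)
(* MathComp / MathComp-Analysis. *)
From mathcomp Require Import all_boot all_order all_algebra.
From mathcomp Require Import reals sequences exp.

Set Implicit Arguments.
Unset Strict Implicit.
Unset Printing Implicit Defensive.

Import Order.TTheory GRing.Theory Num.Theory.

Local Open Scope ring_scope.

Section Graphs.
Variable T : finType.
Implicit Types (G : rel T) (A B C : {set T}) (s : seq T).

(* [cycle G s] is a closed directed walk, of length [size s], so that self-loops
   ([s = [:: x]]) are excluded as well. *)
Definition is_dag G : Prop := forall s, cycle G s -> s = [::].

Definition parents G (j : T) : {set T} := [set i | G i j].

Definition adjacent G : rel T := [rel u v | G u v || G v u].

(* [connect] is reflexive: the descendants of [v] include [v] itself. *)
Definition descendants G (v : T) : {set T} := [set d | connect G v d].

(* [C] blocks [s] at an interior vertex [v], between its neighbours [u], [w] on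
   [s], if [v] is a collider with no descendant in [C], or else a noncollider
   in [C]. *)
Definition blocked G C s : Prop := exists u v w : T,
  infix [:: u; v; w] s /\
  (if G u v && G w v then [disjoint descendants G v & C] else v \in C).

Definition d_separated G A B C : Prop := forall (x : T) s,
  x \in A -> last x s \in B -> path (adjacent G) x s -> uniq (x :: s) ->
  blocked G C (x :: s).

Definition markov_equivalent G G' : Prop := forall A B C,
  [disjoint A & B] -> [disjoint A & C] -> [disjoint B & C] ->
  (d_separated G A B C <-> d_separated G' A B C).

End Graphs.

Section Score.
Variables (R : realType) (n p : nat) (X : 'M[R]_(n, p)).
Implicit Types (S : {set 'I_p}) (j : 'I_p) (G : rel 'I_p).

Definition submx_cols S : 'M[R]_(n, #|S|) :=
  colsub (fun k : 'I_#|S| => enum_val k) X.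

Definition gram S : 'M[R]_#|S| := (submx_cols S)^T *m submx_cols S.

(* For [S = set0] the inner dimension is 0 and the product is 0. *)
Definition proj_cols S : 'M[R]_n :=
  submx_cols S *m invmx (gram S) *m (submx_cols S)^T.

(* The unique entry of the 1 x 1 matrix. *)
Definition rss j S : R :=
  ((col j X)^T *m (1%:M - proj_cols S) *m col j X) ord0 ord0.

Variables (c1 c2 gamma kappa alpha : R).

Definition exp_psi_node j S : R :=
  (c1 * p%:R `^ c2) ^- #|S|
  * (1 + alpha * gamma^-1) `^ (- (#|S|%:R / 2))
  * rss j S `^ (- ((alpha * n%:R + kappa) / 2)).

(* [psi_node] is determined by [expR (psi_node j S) = exp_psi_node j S]; see
   [expR_psi_node]. *)
Definition psi_node j S : R := ln (exp_psi_node j S).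

Definition psi G : R := \sum_(j < p) psi_node j (parents G j).

Definition psi_defined G : Prop := forall j,
  gram (parents G j) \in unitmx /\ 0 < rss j (parents G j).

Lemma expR_psi_node j S :
  0 < c1 -> 0 < gamma -> 0 < alpha -> 0 < rss j S ->
  expR (psi_node j S) = exp_psi_node j S.
Proof.
move=> c1_gt0 g_gt0 a_gt0 rss_gt0; rewrite /psi_node lnK // posrE.
have p_gt0 : 0 < p%:R :> R by rewrite ltr0n (leq_ltn_trans _ (ltn_ord j)).
rewrite !mulr_gt0 ?powR_gt0 ?invr_gt0 ?exprn_gt0 ?mulr_gt0 ?powR_gt0 //.
by rewrite addr_gt0 // mulr_gt0 // invr_gt0.
Qed.

End Score.

(* Main.v *)
(* Each local score is a difference [f (j |: Pa j) - f (Pa j)] for a function [f]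
   of vertex sets that does not depend on the graph, because the residual sum of
   squares is the ratio of the Gram determinants of [j |: Pa j] and [Pa j]. The
   score is then the pairing of [f] with the integer-valued function
   [A |-> sum_j ([A = j |: Pa j] - [A = Pa j])]. This function is determined by
   its sums over the supersets of each [S], which are [1] if some [j] in [S] is a
   child of all other elements of [S], and [0] otherwise; and that condition
   depends only on the skeleton and the immoralities of the graph, both of which
   are seen by the separations of nonadjacent [x], [y] given [Pa x]. Unlike a
   chain of covered edge reversals, this involves no intermediate graphs, for
   which the score might be undefined. *)
Require Import Defs.
From mathcomp Require Import all_boot all_order all_algebra.
From mathcomp Require Import fingroup perm.
From mathcomp Require Import reals sequences exp.
From mathcomp Require Import ring.

Set Implicit Arguments.
Unset Strict Implicit.
Unset Printing Implicit Defensive.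

(* [sequences] also exports an [adjacent]. *)
Import Defs.
Import Order.TTheory GRing.Theory Num.Theory.

Local Open Scope ring_scope.

(** Möbius inversion: by induction on the size of the complement, [d] and [d'] agree on the strict
    supersets of [A], and cancelling those leaves the values at [A]. *)
Lemma superset_sums_inj (T : finType) (V : zmodType) (d d' : {set T} -> V) :
    (forall S : {set T}, \sum_(A : {set T} | S \subset A) d A
                       = \sum_(A : {set T} | S \subset A) d' A) ->
  d =1 d'.
Proof.
move=> dd' A; have [m] := ubnP #|~: A|; elim: m A => // m IHm A.
rewrite ltnS => leAm; have := dd' A.
rewrite (bigD1 A) // [RHS](bigD1 A) //=.
rewrite (eq_bigr d') => [/addIr // | B /andP[sAB neBA]].
apply: IHm; apply: leq_trans leAm; apply: proper_card.
by rewrite properEneq setCS sAB (inj_eq (can_inj (@setCK _))) neBA.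
Qed.

Lemma infix_same_size (T : eqType) (s t : seq T) :
  size s = size t -> infix s t -> s = t.
Proof.
by move=> eqst /infixW/size_subseq_leqif[_]; rewrite eqst eqxx => /esym/eqP.
Qed.

(** * Acyclicity and d-separation *)

Section Dags.
Variable T : finType.
Implicit Types (G : rel T) (x y : T) (A S : {set T}).

Lemma dag_connect G x y : is_dag G -> connect G x y -> ~~ G y x.
Proof.
move=> dagG /connectP[s Gs ->]; apply/negP=> Gyx.
by have /= := dagG (x :: s); rewrite rcons_path Gs Gyx => /(_ isT).
Qed.

Lemma dag_irr G x : is_dag G -> ~~ G x x.
Proof. by move=> /dag_connect; apply. Qed.

Lemma dag_asym G x y : is_dag G -> G x y -> ~~ G y x.
Proof. by move=> dagG /connect1; apply: dag_connect. Qed.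

(** A member with fewest descendants works: a child of it would have strictly fewer. *)
Lemma dag_sink G A x : is_dag G -> x \in A ->
  exists2 d, d \in A & forall e, e \in A -> ~~ G d e.
Proof.
move=> dagG Ax; case: (arg_minnP (fun d => #|descendants G d|) Ax) => d Ad dmin.
exists d => // e Ae; apply/negP => Gde.
have := dmin e Ae; rewrite leqNgt => /negP; apply; apply/proper_card/properP.
split; first by apply/subsetP => z; rewrite !inE; apply/connect_trans/connect1.
exists d; rewrite inE ?connect0 //.
by apply/negP => /(dag_connect dagG); rewrite Gde.
Qed.

(** A path going forward from a descendant [u] of [x] but ending at a nondescendant must turn back.
    The first turn is a collider below [x], and by acyclicity no descendant of it is a parent of
    [x]. *)
Lemma parents_block_descending G x u v s : is_dag G ->
    connect G x u -> G u v -> ~~ connect G x (last v s) ->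
    path (adjacent G) v s ->
  blocked G (parents G x) [:: u, v & s].
Proof.
move=> dagG; elim: s u v => [|w s IHs] u v xu Guv /= nxl.
  by case/negP: nxl; apply: connect_trans xu (connect1 Guv).
case/andP=> Avw vs; have xv := connect_trans xu (connect1 Guv).
have [Gwv | nGwv] := boolP (G w v).
  exists u, v, w; split; first exact: (prefix_infix [:: u; v; w]).
  rewrite Guv Gwv disjoint_subset; apply/subsetP => d; rewrite !inE => vd.
  by apply: dag_connect => //; apply: connect_trans xv vd.
have Gvw : G v w by move: Avw; rewrite /adjacent /= (negPf nGwv) orbF.
have [a [b [c [abc blk]]]] := IHs v w xv Gvw nxl vs.
by exists a, b, c; split=> //; rewrite infix_consl abc orbT.
Qed.

Lemma adjacentE G x y : adjacent G x y = G x y || G y x.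
Proof. by []. Qed.

Lemma adjacent_sym G : symmetric (adjacent G).
Proof. by move=> x y; rewrite /adjacent /= orbC. Qed.

(** If the first edge leaves [x], [parents_block_descending] applies; otherwise the second vertex is
    a noncollider among the parents of [x], and interior because it is not [y]. *)
Lemma d_separated_parents G x y : is_dag G ->
    ~~ adjacent G x y -> ~~ connect G x y ->
  d_separated G [set x] [set y] (parents G x).
Proof.
move=> dagG nAxy nxy u s /set1P-> /set1P; case: s => [|v s] /= lst.
  by rewrite -lst connect0 in nxy.
case/andP => Axv vs _; have [Gxv | nGxv] := boolP (G x v).
  by apply: parents_block_descending => //; rewrite lst.
have Gvx : G v x by move: Axv; rewrite /adjacent /= (negPf nGxv).
case: s lst vs => [|w s] /= lst vs; first by rewrite -lst Axv in nAxy.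
exists x, v, w; split; first exact: (prefix_infix [:: x; v; w]).
by rewrite (negPf nGxv) inE.
Qed.

Lemma not_d_separated_adjacent G x y C : x != y -> adjacent G x y ->
  ~ d_separated G [set x] [set y] C.
Proof.
move=> nexy Axy /(_ x [:: y])[].
- by rewrite inE.
- by rewrite inE.
- by rewrite /= Axy.
- by rewrite /= inE nexy.
by move=> u [v [w [/size_infix]]].
Qed.

Lemma dag_adjacent_connect G x y : is_dag G ->
  adjacent G x y -> connect G x y -> G x y.
Proof. by move=> dagG /orP[] // Gyx /(dag_connect dagG)/negP. Qed.

Lemma dag_connect_anti G x y :
  is_dag G -> connect G x y -> connect G y x -> x = y.
Proof.
move=> dagG xy /connectP[[//|z s] /= /andP[Gyz zs] lst].
have: ~~ G y z; last by rewrite Gyz.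
apply: dag_connect => //; rewrite lst in xy; apply: connect_trans xy.
by apply/connectP; exists s.
Qed.

(** * Skeleton and immoralities from Markov equivalence *)

Section MarkovEquivalent.
Variables G G' : rel T.
Hypotheses (dagG : is_dag G) (dagG' : is_dag G').
Hypothesis GG' : markov_equivalent G G'.

Lemma markov_d_separated_parents x y : x != y ->
    ~~ adjacent G x y -> ~~ connect G x y ->
  d_separated G' [set x] [set y] (parents G x).
Proof.
move=> nexy nAxy nxy; apply/GG'; last exact: d_separated_parents.
- by rewrite disjoints1 inE.
- by rewrite disjoints1 inE dag_irr.
- rewrite disjoints1 inE; apply: contra nAxy => Gyx.
  by rewrite adjacentE Gyx orbT.
Qed.

Lemma markov_adjacent x y : adjacent G' x y -> adjacent G x y.
Proof.
apply: contraTT => nAxy; have [<-|nexy] := eqVneq x y.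
  by rewrite adjacentE (negPf (dag_irr _ dagG')).
(* By acyclicity one of [x], [y] does not reach the other, and the claim is symmetric. *)
wlog nxy: x y nexy nAxy / ~~ connect G x y.
  move=> wl; have [xy|] := boolP (connect G x y); last exact: wl.
  rewrite adjacent_sym; apply: wl; rewrite 1?eq_sym 1?adjacent_sym //.
  by apply: contra nexy => yx; apply/eqP/(dag_connect_anti dagG).
apply/negP => /(not_d_separated_adjacent nexy); apply.
exact: markov_d_separated_parents.
Qed.

Hypothesis skel : adjacent G =2 adjacent G'.

(** The parents of [a] in [G] block the path [a], [c], [b] in [G']; as [c] is not one of them, it
    must be a collider there. *)
Lemma markov_immorality a b c : G a c -> G b c -> a != b -> ~~ adjacent G a b ->
  G' a c && G' b c.
Proof.
move=> Gac Gbc neab nAab.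
wlog nab: a b Gac Gbc neab nAab / ~~ connect G a b.
  move=> wl; have [ab|] := boolP (connect G a b); last exact: wl.
  rewrite andbC; apply: wl; rewrite 1?eq_sym 1?adjacent_sym //.
  by apply: contra neab => ba; apply/eqP/(dag_connect_anti dagG).
have /(_ a [:: c; b])[] := markov_d_separated_parents neab nAab nab.
- by rewrite inE.
- by rewrite inE.
- by rewrite /= -!skel !adjacentE Gac Gbc orbT.
- rewrite /= !inE negb_or neab.
  by rewrite !andbT; apply/andP; split; apply: contraTN isT => /eqP eqc;
    [move: Gac | move: Gbc]; rewrite eqc (negPf (dag_irr _ dagG)).
move=> u [v [w [/infix_same_size-/(_ erefl)[-> -> ->]]]].
by case: ifP => // _; rewrite inE (negPf (dag_asym dagG Gac)).
Qed.

End MarkovEquivalent.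

(** * Characteristic and standard imsets *)

(* As a function of [S], this is Studeny's characteristic imset. *)
Definition char_imset G S := [exists j in S, S :\ j \subset parents G j].

Lemma char_imset_mono G G' S : is_dag G' -> adjacent G =2 adjacent G' ->
    (forall a b c, G a c -> G b c -> a != b -> ~~ adjacent G a b ->
       G' a c && G' b c) ->
  char_imset G S -> char_imset G' S.
Proof.
move=> dagG' skel imm /exists_inP[j Sj /subsetP dom].
have Gj a : a \in S -> a != j -> G a j.
  by move=> Sa neaj; have := dom a; rewrite !inE neaj Sa => /(_ isT).
(* If [j] has children in [S] in [G'], a sink [d] among them takes over: every
   other [a] in [S] is adjacent to [d], as otherwise [a -> j <- d]
   would be an immorality. *)
have [D0 | [d0 Dd0]] := set_0Vmem [set d in S | G' j d].
  apply/exists_inP; exists j => //; apply/subsetP => a.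
  rewrite !inE => /andP[neaj Sa]; have := skel a j; rewrite !adjacentE Gj //=.
  case/esym/orP => // Gja; have: a \in [set d in S | G' j d] by rewrite inE Sa.
  by rewrite D0 inE.
have [d] := dag_sink dagG' Dd0; rewrite inE => /andP[Sd Gjd] dsink.
have nejd : d != j by apply: contraTneq Gjd => ->; apply: dag_irr.
apply/exists_inP; exists d => //; apply/subsetP => a.
rewrite !inE => /andP[nead Sa]; have [-> // | neaj] := eqVneq a j.
have Aad : adjacent G' a d.
  rewrite -skel; apply/negPn/negP => nAad.
  have /andP[_ Gdj] := imm a d j (Gj a Sa neaj) (Gj d Sd nejd) nead nAad.
  by rewrite (negPf (dag_asym dagG' Gjd)) in Gdj.
(* Either [a] is a child of [j], and the sink [d] has no edge to it, or [a -> j -> d] in [G'] and an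
   edge [d -> a] would close a cycle. *)
have [Gja | nGja] := boolP (G' j a).
  move: Aad => /orP[] // Gda.
  by have := dsink a; rewrite inE Sa Gja Gda => /(_ isT).
apply: (dag_adjacent_connect dagG') => //; apply: connect_trans (connect1 Gjd).
apply: connect1; have := skel a j.
by rewrite !adjacentE Gj // (negPf nGja) orbF => <-.
Qed.

(* Up to the terms for the full and the empty set, the negative of Studeny's
   standard imset of [G]. *)
Definition imset G A : int :=
  \sum_j ((A == j |: parents G j)%:R - (A == parents G j)%:R).

Lemma sum_imset (V : zmodType) (f : {set T} -> V) G :
  \sum_A f A *~ imset G A = \sum_j (f (j |: parents G j) - f (parents G j)).
Proof.
under eq_bigr do rewrite mulrz_sumr; rewrite exchange_big /=.
have pt B : \sum_A f A *~ (A == B)%:R = f B.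
  rewrite (bigD1 B) //= eqxx mulr1z big1 ?addr0 // => A /negPf->.
  exact: mulr0z.
by apply: eq_bigr => j _; under eq_bigr do rewrite mulrzBr; rewrite sumrB !pt.
Qed.

(** The term of [j] tests whether [S] lies inside [j |: parents G j] but not inside [parents G j];
    two such [j] would be parents of each other. *)
Lemma superset_sum_imset G S : is_dag G ->
  \sum_(A : {set T} | S \subset A) imset G A = (char_imset G S)%:R.
Proof.
move=> dagG; rewrite /imset exchange_big /=.
have pt (B : {set T}) :
    \sum_(A : {set T} | S \subset A) (A == B)%:R = (S \subset B)%:R :> int.
  have [sSB|nsSB] := boolP (S \subset B).
    by rewrite (bigD1 B) //= eqxx big1 ?addr0 // => A /andP[_ /negPf->].
  by rewrite big1 // => A sSA; case: eqP => // eqAB; rewrite -eqAB sSA in nsSB.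
have term j : \sum_(A : {set T} | S \subset A)
      ((A == j |: parents G j)%:R - (A == parents G j)%:R) =
    ((j \in S) && (S :\ j \subset parents G j))%:R :> int.
  rewrite sumrB !pt subDset; have [Sj|nSj] := boolP (j \in S).
    have /negPf-> : ~~ (S \subset parents G j); last by rewrite subr0.
    by apply/subsetPn; exists j; rewrite // inE dag_irr.
  by rewrite -subDset (setDidPl _) ?subrr // disjoint_sym disjoints1.
under eq_bigr do rewrite term.
have [/exists_inP[j Sj jS] | none] := boolP (char_imset G S).
  rewrite (bigD1 j) //= Sj jS big1 ?addr0 // => k nekj.
  case: (boolP (k \in S)) => //= Sk; have [kS|//] := boolP (_ \subset _).
  have := subsetP jS k; have := subsetP kS j.
  rewrite !inE nekj Sk Sj eq_sym nekj.
  by move=> /(_ isT) Gjk /(_ isT); rewrite (negPf (dag_asym dagG Gjk)).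
rewrite big1 // => j _; case: andP => // -[Sj jS].
by case/exists_inP: none; exists j.
Qed.

Lemma markov_equivalent_sum (V : zmodType) (f : {set T} -> V) G G' :
    is_dag G -> is_dag G' -> markov_equivalent G G' ->
  \sum_j (f (j |: parents G j) - f (parents G j)) =
  \sum_j (f (j |: parents G' j) - f (parents G' j)).
Proof.
move=> dagG dagG' GG'.
have G'G : markov_equivalent G' G by move=> A B C *; apply: iff_sym; apply: GG'.
have skel : adjacent G =2 adjacent G'.
  by move=> x y; apply/idP/idP; apply: markov_adjacent.
have skel' : adjacent G' =2 adjacent G by move=> x y; rewrite skel.
rewrite -!sum_imset; apply: eq_bigr => A _; congr (_ *~ _).
apply: superset_sums_inj A => S; rewrite !superset_sum_imset //.
congr (nat_of_bool _)%:R.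
apply/idP/idP; apply: char_imset_mono => //; exact: markov_immorality.
Qed.

End Dags.

(** * Gram determinants *)

Lemma det_mxsub_image (R : comRingType) (T : finType) (M : T -> T -> R)
    (m m' : nat) (e : 'I_m -> T) (e' : 'I_m' -> T) :
    injective e -> injective e' -> codom e =i codom e' ->
  \det (\matrix_(i, k) M (e i) (e k)) = \det (\matrix_(i, k) M (e' i) (e' k)).
Proof.
move=> inj_e inj_e' ee'.
have eqm : m = m'.
  by have := eq_card ee'; rewrite !card_codom // !card_ord.
case: _ / eqm in e' inj_e' ee' *.
have /fin_all_exists[s es] i : exists k, e' i = e k.
  by apply/codomP; rewrite ee' codom_f.
have inj_s : injective s by move=> i k eqs; apply: inj_e'; rewrite !es eqs.
have -> : \matrix_(i, k) M (e' i) (e' k) = row_perm (perm inj_s)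
    (col_perm (perm inj_s) (\matrix_(i, k) M (e i) (e k))).
  by apply/matrixP => i k; rewrite !mxE !permE !es.
rewrite row_permE col_permE !det_mulmx !det_perm odd_permV mulrCA.
by rewrite -expr2 sqrr_sign mulr1.
Qed.

(** Right multiplication by a unipotent block matrix clears the lower left block. *)
Lemma det_schur (F : fieldType) (m1 m2 : nat) (A : 'M[F]_m1) (B : 'M_(m1, m2))
    (C : 'M_(m2, m1)) (D : 'M_m2) : D \in unitmx ->
  \det (block_mx A B C D) = \det (A - B *m invmx D *m C) * \det D.
Proof.
move=> uD; have := det_mulmx (block_mx A B C D)
  (block_mx 1%:M 0 (- (invmx D *m C)) 1%:M).
rewrite mulmx_block !mulmx1 !mulmx0 !add0r !mulmxN (mulKVmx uD) subrr mulmxA.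
by rewrite det_ublock det_lblock !det1 !mulr1 => <-.
Qed.

Section Gram.
Variables (R : realType) (n p : nat) (X : 'M[R]_(n, p)).
Implicit Types (S : {set 'I_p}) (j : 'I_p).

Lemma det_gram_setU1 j S : j \notin S -> gram X S \in unitmx ->
  \det (gram X (j |: S)) = rss X j S * \det (gram X S).
Proof.
(* Listing [j] first gives a block matrix in which the Schur complement of [gram X S] has
   [rss X j S] as its only entry. *)
move=> nSj uS; pose e (i : 'I_(1 + #|S|)) :=
  match split i with inl _ => j | inr k => enum_val k end.
have inj_e : injective e.
  move=> i k; rewrite -[i]splitK -[k]splitK /e !unsplitK.
  case: (split i) (split k) => [i1|i2] [k1|k2] //=.
  - by rewrite !ord1.
  - by move=> eqj; case/negP: nSj; rewrite eqj enum_valP.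
  - by move=> eqj; case/negP: nSj; rewrite -eqj enum_valP.
  - by move/enum_val_inj ->.
have gramE A : gram X A =
    \matrix_(i, k) (X^T *m X) (enum_val i) (enum_val k).
  by apply/matrixP => i k; rewrite !mxE; apply: eq_bigr => l _; rewrite !mxE.
rewrite gramE (@det_mxsub_image _ _ _ _ _ _ e) //; first last.
- move=> x; apply/idP/idP => [/codomP[i ->] | /codomP[i ->]].
    have := enum_valP i; rewrite in_setU1 => /orP[/eqP-> | Si].
      by apply/codomP; exists (lshift _ ord0); rewrite /e (unsplitK (inl _)).
    apply/codomP; exists (rshift 1 (enum_rank_in Si (enum_val i))).
    by rewrite /e (unsplitK (inr _)) enum_rankK_in.
  have Se : e i \in j |: S.
    by rewrite /e; case: split => ?; rewrite !inE ?eqxx // enum_valP orbT.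
  by apply/codomP; exists (enum_rank_in Se (e i)); rewrite enum_rankK_in.
- exact: enum_val_inj.
have -> : \matrix_(i, k) (X^T *m X) (e i) (e k) =
    block_mx ((col j X)^T *m col j X) ((col j X)^T *m submx_cols X S)
             ((submx_cols X S)^T *m col j X) (gram X S).
  apply/matrixP => i k; rewrite -[i]splitK -[k]splitK.
  case: (split i) (split k) => [i1|i2] [k1|k2] /=;
    rewrite ?block_mxEul ?block_mxEur ?block_mxEdl ?block_mxEdr !mxE /e;
    rewrite ?(unsplitK (inl _)) ?(unsplitK (inr _));
    by apply: eq_bigr => l _; rewrite !mxE.
rewrite det_schur // det_mx11; congr (_ * _).
by rewrite /rss /proj_cols mulmxBr mulmx1 mulmxBl !mulmxA.
Qed.

End Gram.

(** * Local scores as increments of a potential *)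

Section PsiNode.
Variables (R : realType) (n p : nat) (X : 'M[R]_(n, p)).
Variables (c1 c2 gamma kappa alpha : R).

(* The term ['C(#|S|, 2)] is there because its increment from [S] to [j |: S]
   is [#|S|]. *)
Definition psi_potential (S : {set 'I_p}) : R :=
  - ('C(#|S|, 2)%:R * (ln (c1 * p%:R `^ c2) + ln (1 + alpha * gamma^-1) / 2))
  - (alpha * n%:R + kappa) / 2 * ln `|\det (gram X S)|.

Lemma psi_nodeE (j : 'I_p) (S : {set 'I_p}) :
    0 < c1 -> 0 < gamma -> 0 < alpha -> j \notin S ->
    gram X S \in unitmx -> 0 < rss X j S ->
  psi_node X c1 c2 gamma kappa alpha j S =
    psi_potential (j |: S) - psi_potential S.
Proof.
move=> c1_gt0 g_gt0 a_gt0 nSj uS rss_gt0.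
have p_gt0 : 0 < p%:R :> R by rewrite ltr0n (leq_ltn_trans _ (ltn_ord j)).
have a1 : 0 < c1 * p%:R `^ c2 by rewrite mulr_gt0 ?powR_gt0.
have a2 : 0 < 1 + alpha * gamma^-1 by rewrite addr_gt0 // mulr_gt0 // invr_gt0.
(* Thanks to the absolute value, invertibility is enough to split the logarithm. *)
have det_gt0 : 0 < `|\det (gram X S)|.
  by rewrite normr_gt0 -unitfE -unitmxE.
rewrite /psi_node /exp_psi_node /psi_potential det_gram_setU1 // normrM.
rewrite (gtr0_norm rss_gt0).
move: (c1 * _) (1 + _) a1 a2 => a b a1 a2.
rewrite !lnM ?posrE ?mulr_gt0 ?powR_gt0 ?invr_gt0 ?exprn_gt0 //.
rewrite lnV ?posrE ?exprn_gt0 // lnXn // !ln_powR.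
rewrite cardsU1 nSj binS bin1 natrD -mulr_natr.
by field.
Qed.

End PsiNode.

Theorem lemma3 (R : realType) (n p : nat) (X : 'M[R]_(n, p))
    (c1 c2 gamma kappa alpha : R) (G G' : rel 'I_p)
    (c1_gt0 : 0 < c1) (c2_ge0 : 0 <= c2) (gamma_gt0 : 0 < gamma)
    (kappa_ge0 : 0 <= kappa) (alpha01 : 0 < alpha < 1)
    (G_dag : is_dag G) (G'_dag : is_dag G')
    (G_def : psi_defined X G) (G'_def : psi_defined X G')
    (GG' : markov_equivalent G G') :
  psi X c1 c2 gamma kappa alpha G = psi X c1 c2 gamma kappa alpha G'.
Proof.
have [a_gt0 _] := andP alpha01.
(* The potential is common to both graphs; only the sets at which it is evaluated differ. *)
have psiE H : is_dag H -> psi_defined X H -> psi X c1 c2 gamma kappa alpha H =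
    \sum_j (psi_potential X c1 c2 gamma kappa alpha (j |: parents H j)
            - psi_potential X c1 c2 gamma kappa alpha (parents H j)).
  move=> dagH defH; apply: eq_bigr => j _; have [uj rj] := defH j.
  by apply: psi_nodeE; rewrite // inE dag_irr.
by rewrite !psiE //; apply: markov_equivalent_sum.
Qed.
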